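(* Let $R$ be a (skew-invertible) Hecke symmetry on $V^{\otimes 2}$, $\dim_{\mathbb{C}} V=N$, and consider the quantum double $(\hat{\mathcal L}(R),\mathcal M(R))$ formed by the modified reflection equation algebra $\hat{\mathcal L}(R)$ with generating matrix $\hat L=(\hat l_i^{\,j})_{1\le i,j\le N}$ and the reflection equation algebra $\mathcal M(R)$ with generating matrix $M=(m_i^j)_{1\le i,j\le N}$, equipped with the permutation relations $$R_{12}\hat L_1R_{12}M_1-M_1R_{12}\hat L_1R_{12}=R_{12}M_1-M_1R_{12}.$$ Then for every integer $k\ge 1$ the following relation holds in the algebra generated by the double: $$\hat L\,\mathrm{Tr}_R(M^k)=\mathrm{Tr}_R(M^k)\,\hat L$$ (that is, every entry of $\hat L$ commutes with the element $\mathrm{Tr}_R(M^k)$), and consequently, for the action $\triangleright$ of $\hat{\mathcal L}(R)$ on $\mathcal M(R)$ defined by the double and the homomorphism $\varepsilon(\hat L)=0$, $$\hat L\triangleright \mathrm{Tr}_R M^k=0 .$$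
   Context: $V$ is a complex vector space of dimension $N$ and $I$ denotes the identity operator on $V$ (or the $N\times N$ unit matrix). A braiding is a linear operator $R:V^{\otimes 2}\to V^{\otimes 2}$ with $(R\otimes I)(I\otimes R)(R\otimes I)=(I\otimes R)(R\otimes I)(I\otimes R)$. A Hecke symmetry is a braiding satisfying $R^2=I\otimes I+(q-q^{-1})R$ with $q\in\mathbb{C}\setminus\{\pm1,0\}$. $R_{12}=R$ acts on the first two tensor factors, and for a matrix $X$ put $X_1=X\otimes I$. The algebras. $\mathcal M(R)$ is the unital associative algebra generated by the entries of $M$ subject to $R_{12}M_1R_{12}M_1-M_1R_{12}M_1R_{12}=0$. $\hat{\mathcal L}(R)$ is the unital associative algebra generated by the entries of $\hat L$ subject to $R_{12}\hat L_1R_{12}\hat L_1-\hat L_1R_{12}\hat L_1R_{12}=R_{12}\hat L_1-\hat L_1R_{12}$. Quantum double. A double $(A,B)$ of unital associative algebras is a pair equipped with an invertible linear permutation map $\sigma:A\otimes B\to B\otimes A$ such that $\sigma\circ(\mu_A\otimes \mathrm{id}_B)=(\mathrm{id}_B\otimes\mu_A)\circ\sigma_{12}\circ\sigma_{23}$ on $A\otimes A\otimes B$, $\sigma\circ(\mathrm{id}_A\otimes\mu_B)=(\mu_B\otimes\mathrm{id}_A)\circ\sigma_{23}\circ\sigma_{12}$ on $A\otimes B\otimes B$, $\sigma(1_A\otimes b)=b\otimes 1_A$ and $\sigma(a\otimes 1_B)=1_B\otimes a$, where $\mu_A,\mu_B$ are the multiplications. It gives a unital associative algebra, isomorphic to $B\otimes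 A$ as a vector space, which is the quotient of the free tensor algebra $T(A\oplus B)$ by the multiplication rules of $A$ and $B$ and the permutation relations $a\otimes b=\sigma(a\otimes b)$. Here $A=\hat{\mathcal L}(R)$, $B=\mathcal M(R)$ and $\sigma$ is the map determined on generators by $$\sigma:\ R_{12}\hat L_1R_{12}\otimes M_1\mapsto M_1\otimes R_{12}\hat L_1R_{12}+(R_{12}M_1-M_1R_{12})\otimes 1_A ,$$ which yields the permutation relations in the claim (tensor signs and units are omitted). Action. For an algebra homomorphism $\varepsilon:A\to\mathbb{C}$ the action of $A$ on $B$ is $a\triangleright b=(\mathrm{id}_B\otimes\varepsilon)\,\sigma(a\otimes b)$. Here $\varepsilon:\hat{\mathcal L}(R)\to\mathbb{C}$ is the homomorphism with $\varepsilon(1_A)=1$ and $\varepsilon(\hat l_i^{\,j})=0$ for all $i,j$. The formula $\hat L\triangleright b=0$ means $\hat l_i^{\,j}\triangleright b=0$ for all $i,j$. $R$-trace. $R$ is skew-invertible if there is $\Psi\in\mathrm{End}(V^{\otimes2})$ with $\mathrm{Tr}_{(2)}R_{12}\Psi_{23}=\mathrm{Tr}_{(2)}\Psi_{12}R_{23}=P_{13}$, where $P$ is the flip. Put $C=\mathrm{Tr}_{(2)}\Psi_{12}\in\mathrm{End}(V)$. For an $N\times N$ matrix $X$ with entries in an algebra, $\mathrm{Tr}_RX=\mathrm{Tr}(CX)$. $M^k$ is the usual $k$-th matrix power. *)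

(* Defs.v *)
From HB Require Import structures.
From mathcomp Require Import all_boot all_algebra.
From mathcomp Require Import boolp reals finmap.
From mathcomp Require Import mxtens complex.
From mathcomp Require Import monalg.

Set Implicit Arguments.
Unset Strict Implicit.
Unset Printing Implicit Defensive.

Import GRing.Theory.
Local Open Scope ring_scope.
Local Open Scope quotient_scope.

Section SpanQuotient.
Context {K : comNzRingType} {V : lmodType K} (S : V -> Prop).

Inductive in_span : V -> Prop :=
| Span_gen v of S v : in_span v
| Span_0 : in_span 0
| Span_lin c u v of in_span u & in_span v : in_span (c *: u + v).

Definition span_pred : {pred V} := fun v => `[< in_span v >].

Lemma span_predP v : reflect (in_span v) (v \in span_pred).
Proof. exact: asboolP. Qed.

Fact span_zmod_closed : zmod_closed span_pred.
Proof.
split=> [|u v /span_predP hu /span_predP hv]; apply/span_predP.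
  exact: Span_0.
by rewrite addrC -scaleN1r; apply: Span_lin.
Qed.
HB.instance Definition _ := GRing.isZmodClosed.Build V span_pred
  span_zmod_closed.

Definition span_quot : Type := Quotient.quot span_pred.
HB.instance Definition _ := GRing.Zmodule.on span_quot.
HB.instance Definition _ := EqQuotient.on span_quot.
HB.instance Definition _ := ZmodQuotient.on span_quot.

Definition span_proj (v : V) : span_quot := \pi_span_quot v.

Lemma span_reprK x : span_proj (repr x) = x.
Proof. exact: reprK. Qed.

Lemma span_projD : {morph span_proj : u v / u + v}.
Proof. by move=> u v; rewrite /span_proj raddfD. Qed.

Lemma span_proj_eqP u v : reflect (in_span (u - v)) (span_proj u == span_proj v).
Proof. by rewrite -[_ == _]Quotient.idealrBE; apply: span_predP. Qed.

Definition span_scale (c : K) (x : span_quot) : span_quot :=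
  span_proj (c *: repr x).

Lemma span_scaleE c u : span_scale c (span_proj u) = span_proj (c *: u).
Proof.
apply/eqP/span_proj_eqP; rewrite -scalerBr -[_ *: _]addr0.
by apply: Span_lin Span_0; apply/span_proj_eqP; rewrite span_reprK.
Qed.

Fact span_scaleA a b x : span_scale a (span_scale b x) = span_scale (a * b) x.
Proof. by rewrite -[x]span_reprK !span_scaleE scalerA. Qed.
Fact span_scale1 : left_id 1 span_scale.
Proof. by move=> x; rewrite -[x]span_reprK span_scaleE scale1r. Qed.
Fact span_scaleDr : right_distributive span_scale +%R.
Proof.
move=> a x y; rewrite -[x]span_reprK -[y]span_reprK -span_projD !span_scaleE scalerDr.
by rewrite span_projD.
Qed.
Fact span_scaleDl x : {morph span_scale^~ x : a b / a + b}.
Proof.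
by move=> a b; rewrite -[x]span_reprK !span_scaleE scalerDl span_projD.
Qed.
HB.instance Definition _ := GRing.Zmodule_isLmodule.Build K span_quot
  span_scaleA span_scale1 span_scaleDr span_scaleDl.

Fact span_proj_is_linear : linear span_proj.
Proof. by move=> c u v; rewrite span_projD -span_scaleE. Qed.
HB.instance Definition _ := GRing.isLinear.Build K V span_quot *:%R span_proj
  span_proj_is_linear.

End SpanQuotient.

Section IdealQuotient.
Context {K : comNzRingType} {F : algType K} (S : F -> Prop).

Inductive in_ideal : F -> Prop :=
| Ideal_gen x of S x : in_ideal x
| Ideal_0 : in_ideal 0
| Ideal_add x y of in_ideal x & in_ideal y : in_ideal (x + y)
| Ideal_mull a x of in_ideal x : in_ideal (a * x)
| Ideal_mulr a x of in_ideal x : in_ideal (x * a).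

Definition ideal_pred : {pred F} := fun x => `[< in_ideal x >].

Lemma ideal_predP x : reflect (in_ideal x) (x \in ideal_pred).
Proof. exact: asboolP. Qed.

Fact ideal_zmod_closed : zmod_closed ideal_pred.
Proof.
split=> [|x y /ideal_predP hx /ideal_predP hy]; apply/ideal_predP.
  exact: Ideal_0.
by rewrite -mulN1r; apply: Ideal_add => //; apply: Ideal_mull.
Qed.
HB.instance Definition _ := GRing.isZmodClosed.Build F ideal_pred
  ideal_zmod_closed.

Definition alg_quot : Type := Quotient.quot ideal_pred.
HB.instance Definition _ := GRing.Zmodule.on alg_quot.
HB.instance Definition _ := EqQuotient.on alg_quot.
HB.instance Definition _ := ZmodQuotient.on alg_quot.

Definition alg_proj (x : F) : alg_quot := \pi_alg_quot x.

Lemma alg_reprK x : alg_proj (repr x) = x.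
Proof. exact: reprK. Qed.

Lemma alg_projD : {morph alg_proj : x y / x + y}.
Proof. by move=> x y; rewrite /alg_proj raddfD. Qed.

Lemma alg_proj_eqP x y : reflect (in_ideal (x - y)) (alg_proj x == alg_proj y).
Proof. by rewrite -[_ == _]Quotient.idealrBE; apply: ideal_predP. Qed.

Lemma in_ideal_repr (x : F) : in_ideal (repr (alg_proj x) - x).
Proof. by apply/alg_proj_eqP; rewrite alg_reprK. Qed.

Definition alg_quot_one : alg_quot := alg_proj 1.
Definition alg_quot_mul (x y : alg_quot) : alg_quot := alg_proj (repr x * repr y).
Definition alg_quot_scale (c : K) (x : alg_quot) : alg_quot :=
  alg_proj (c *: repr x).

Lemma alg_quot_mulE x y : alg_quot_mul (alg_proj x) (alg_proj y) = alg_proj (x * y).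
Proof.
apply/eqP/alg_proj_eqP; set x' := repr _; set y' := repr _.
have -> : x' * y' - x * y = (x' - x) * y' + x * (y' - y).
  by rewrite mulrBl mulrBr addrA subrK.
apply: Ideal_add; [apply: Ideal_mulr | apply: Ideal_mull];
  exact: in_ideal_repr.
Qed.

Lemma alg_quot_scaleE c x : alg_quot_scale c (alg_proj x) = alg_proj (c *: x).
Proof.
apply/eqP/alg_proj_eqP; rewrite -scalerBr -mulr_algl.
by apply: Ideal_mull; apply: in_ideal_repr.
Qed.

Fact alg_quot_mulA : associative alg_quot_mul.
Proof.
move=> x y z; rewrite -[x]alg_reprK -[y]alg_reprK -[z]alg_reprK !alg_quot_mulE.
by rewrite mulrA.
Qed.
Fact alg_quot_mul1q : left_id alg_quot_one alg_quot_mul.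
Proof. by move=> x; rewrite -[x]alg_reprK alg_quot_mulE mul1r. Qed.
Fact alg_quot_mulq1 : right_id alg_quot_one alg_quot_mul.
Proof. by move=> x; rewrite -[x]alg_reprK alg_quot_mulE mulr1. Qed.
Fact alg_quot_mulDl : left_distributive alg_quot_mul +%R.
Proof.
move=> x y z; rewrite -[x]alg_reprK -[y]alg_reprK -[z]alg_reprK -alg_projD !alg_quot_mulE.
by rewrite mulrDl alg_projD.
Qed.
Fact alg_quot_mulDr : right_distributive alg_quot_mul +%R.
Proof.
move=> x y z; rewrite -[x]alg_reprK -[y]alg_reprK -[z]alg_reprK -alg_projD !alg_quot_mulE.
by rewrite mulrDr alg_projD.
Qed.
HB.instance Definition _ := GRing.Zmodule_isPzRing.Build alg_quot
  alg_quot_mulA alg_quot_mul1q alg_quot_mulq1 alg_quot_mulDl alg_quot_mulDr.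

Fact alg_quot_scaleA a b x :
  alg_quot_scale a (alg_quot_scale b x) = alg_quot_scale (a * b) x.
Proof. by rewrite -[x]alg_reprK !alg_quot_scaleE scalerA. Qed.
Fact alg_quot_scale1 : left_id 1 alg_quot_scale.
Proof. by move=> x; rewrite -[x]alg_reprK alg_quot_scaleE scale1r. Qed.
Fact alg_quot_scaleDr : right_distributive alg_quot_scale +%R.
Proof.
move=> a x y; rewrite -[x]alg_reprK -[y]alg_reprK -alg_projD !alg_quot_scaleE scalerDr.
by rewrite alg_projD.
Qed.
Fact alg_quot_scaleDl x : {morph alg_quot_scale^~ x : a b / a + b}.
Proof. by move=> a b; rewrite -[x]alg_reprK !alg_quot_scaleE scalerDl alg_projD. Qed.
HB.instance Definition _ := GRing.Zmodule_isLmodule.Build K alg_quot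
  alg_quot_scaleA alg_quot_scale1 alg_quot_scaleDr alg_quot_scaleDl.

Lemma alg_projM : {morph alg_proj : x y / x * y}.
Proof. by move=> x y; rewrite -alg_quot_mulE. Qed.

Lemma alg_projZ c : {morph alg_proj : x / c *: x}.
Proof. by move=> x; rewrite -alg_quot_scaleE. Qed.

Fact alg_quot_scalerAl (c : K) (x y : alg_quot) : c *: (x * y) = c *: x * y.
Proof.
by rewrite -[x]alg_reprK -[y]alg_reprK -alg_projM -!alg_projZ -alg_projM scalerAl.
Qed.
Fact alg_quot_scalerAr (c : K) (x y : alg_quot) : c *: (x * y) = x * (c *: y).
Proof.
by rewrite -[x]alg_reprK -[y]alg_reprK -alg_projM -!alg_projZ -alg_projM scalerAr.
Qed.

Fact alg_proj_is_linear : linear alg_proj.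
Proof. by move=> c x y; rewrite alg_projD alg_projZ. Qed.
Fact alg_proj_is_monoid_morphism : monoid_morphism alg_proj.
Proof. by split=> //; apply: alg_projM. Qed.
HB.instance Definition _ := GRing.isLinear.Build K F alg_quot *:%R alg_proj
  alg_proj_is_linear.
HB.instance Definition _ := GRing.isMonoidMorphism.Build F alg_quot alg_proj
  alg_proj_is_monoid_morphism.

(* [algType] excludes the zero ring. *)
Definition proper_alg_quot of ~ in_ideal 1 : Type := alg_quot.

Section Proper.
Variable ideal_proper : ~ in_ideal 1.
Local Notation Q := (proper_alg_quot ideal_proper).
HB.instance Definition _ := GRing.PzRing.on Q.
HB.instance Definition _ := GRing.Lmodule.on Q.

Fact proper_alg_quot_neq0 : (1 : Q) != 0.
Proof.
apply/negP; rewrite -[0](raddf0 alg_proj) => /alg_proj_eqP.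
by rewrite subr0.
Qed.
HB.instance Definition _ := GRing.PzSemiRing_isNonZero.Build Q
  proper_alg_quot_neq0.
HB.instance Definition _ := GRing.Lmodule_isLalgebra.Build K Q
  alg_quot_scalerAl.
HB.instance Definition _ := GRing.Lalgebra_isAlgebra.Build K Q
  alg_quot_scalerAr.
End Proper.

End IdealQuotient.

Section Tensor.
Context {K : comNzRingType}.

Definition bilin (A B W : lmodType K) (f : A -> B -> W) : Prop :=
  (forall b, linear (f^~ b)) /\ (forall a, linear (f a)).

Section Def.
Variables A B : lmodType K.

Definition free_tens : lmodType K :=
  {malg K[Choice.clone (A * B)%type _]}.

Inductive tens_rel : free_tens -> Prop :=
| Tens_linl c a a' b :
    tens_rel (<< (c *: a + a', b) >> - (c *: << (a, b) >> + << (a', b) >>))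
| Tens_linr c a b b' :
    tens_rel (<< (a, c *: b + b') >> - (c *: << (a, b) >> + << (a, b') >>)).

Definition tens : lmodType K := span_quot tens_rel.

Definition pure_tens (a : A) (b : B) : tens :=
  span_proj tens_rel << (a, b) >>.

Fact pure_tens_bilin : bilin pure_tens.
Proof.
by split=> [b c a a'|a c b b']; rewrite /pure_tens -[RHS](linearP (span_proj _));
  apply/eqP/span_proj_eqP/Span_gen; [exact: Tens_linl | exact: Tens_linr].
Qed.

End Def.

Section Lift.
Context {A B W : lmodType K} (f : A -> B -> W).

Definition malg_lift (g : free_tens A B) : W :=
  \sum_(p <- msupp g) g@_p *: f p.1 p.2.

(* For bilinear [f] this is the linear map induced by [f], independently of
   the representative: see [tens_liftE] and [tens_lift_linear]. *)
Definition tens_lift (t : tens A B) : W := malg_lift (repr t).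

Lemma malg_liftEw (d : {fset A * B}) g : (msupp g `<=` d)%fset ->
  malg_lift g = \sum_(p <- d) g@_p *: f p.1 p.2.
Proof.
move=> le_gd; apply: big_fset_incl => // p _ /mcoeff_outdom ->.
by rewrite scale0r.
Qed.

Lemma malg_lift_linear : linear malg_lift.
Proof.
move=> c g h; pose d := (msupp (c *: g + h) `|` (msupp g `|` msupp h))%fset.
have le1 : (msupp (c *: g + h) `<=` d)%fset by apply: fsubsetUl.
have le2 : (msupp g `<=` d)%fset.
  by apply: fsubset_trans (fsubsetUr _ _); apply: fsubsetUl.
have le3 : (msupp h `<=` d)%fset.
  by apply: fsubset_trans (fsubsetUr _ _); apply: fsubsetUr.
rewrite !(malg_liftEw le1, malg_liftEw le2, malg_liftEw le3).
rewrite scaler_sumr -big_split /=; apply: eq_bigr => p _.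
by rewrite mcoeffD mcoeffZ scalerDl scalerA.
Qed.

HB.instance Definition _ :=
  GRing.isLinear.Build K _ W *:%R malg_lift malg_lift_linear.

Lemma malg_liftU p : malg_lift << p >> = f p.1 p.2.
Proof.
by rewrite (malg_liftEw msuppU_le) big_seq_fset1 mcoeffUU scale1r.
Qed.

Hypothesis f_bilin : bilin f.

Lemma tens_lift_proj g : tens_lift (span_proj _ g) = malg_lift g.
Proof.
suff malg_lift0 u : in_span (@tens_rel A B) u -> malg_lift u = 0.
  apply/eqP; rewrite -subr_eq0 -raddfB; apply/eqP/malg_lift0.
  by apply/span_proj_eqP; rewrite span_reprK.
elim=> {u} [_ [c a a' b|c a b b']||c u v _ hu _ hv]; last 2 first.
- by rewrite raddf0.
- by rewrite malg_lift_linear hu hv scaler0 addr0.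
- by rewrite (raddfB malg_lift) /= malg_lift_linear !malg_liftU /= (f_bilin.1 b) subrr.
- by rewrite (raddfB malg_lift) /= malg_lift_linear !malg_liftU /= (f_bilin.2 a) subrr.
Qed.

Lemma tens_liftE a b : tens_lift (pure_tens a b) = f a b.
Proof. by rewrite tens_lift_proj malg_liftU. Qed.

Lemma tens_lift_linear : linear tens_lift.
Proof.
move=> c s t; rewrite -[s]span_reprK -[t]span_reprK -(linearP (span_proj _)).
by rewrite !tens_lift_proj malg_lift_linear.
Qed.

End Lift.

Definition tens_map {A A' B B' : lmodType K} (f : A -> A') (g : B -> B') :
    tens A B -> tens A' B' :=
  tens_lift (fun a b => pure_tens (f a) (g b)).

Definition tens_assoc {A B C : lmodType K} :
    tens (tens A B) C -> tens A (tens B C) :=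
  tens_lift (fun t c => tens_lift (fun a b => pure_tens a (pure_tens b c)) t).

Definition tens_assoc_inv {A B C : lmodType K} :
    tens A (tens B C) -> tens (tens A B) C :=
  tens_lift (fun a t => tens_lift (fun b c => pure_tens (pure_tens a b) c) t).

Definition tens_mul {A : algType K} : tens A A -> A :=
  tens_lift (fun a a' : A => a * a').

(* Matrix product in which entries are multiplied by the tensor product. *)
Definition tens_mulmx {A B : lmodType K} {m n p} (X : 'M[A]_(m, n))
    (Y : 'M[B]_(n, p)) : 'M[tens A B]_(m, p) :=
  \matrix_(i, j) \sum_k pure_tens (X i k) (Y k j).

End Tensor.

Section Free.
Context {K : comNzRingType}.

Section FreeAlg.
Variable X : choiceType.

Definition free_monoid : monomType := MonomialDef.clone {fmonom X} _.

Fact fmonom_malg_scalerAr (c : K) (x y : {malg K[free_monoid]}) :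
  c *: (x * y) = x * (c *: y).
Proof.
apply/malgP=> k; rewrite mcoeffZ (mcoeffMl x y).
rewrite (mcoeffMlw _ (fsubset_refl _) (msuppZ_le c y)) mulr_sumr.
apply: eq_bigr => k1 _; rewrite mulr_sumr; apply: eq_bigr => k2 _.
by rewrite mcoeffZ mulrnAr mulrCA.
Qed.

(* The library has no [algType] structure on monoid algebras of noncommutative
   monoids, hence the alias. *)
Definition free_alg : Type := {malg K[free_monoid]}.
HB.instance Definition _ := GRing.Lalgebra.on free_alg.
HB.instance Definition _ := GRing.Lalgebra_isAlgebra.Build K free_alg
  fmonom_malg_scalerAr.

Definition free_gen (x : X) : free_alg := << fmu x >>.

Definition const_coeff (x : free_alg) : K :=
  @mcoeff free_monoid K mone x.
HB.instance Definition _ := GRing.isLinear.Build K free_alg K *%R const_coeff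
  (linearP (@mcoeff free_monoid K mone : {linear {malg K[free_monoid]} -> K | *%R})).
HB.instance Definition _ := GRing.isMonoidMorphism.Build free_alg K const_coeff
  (rmorphism_monoidP (@mcoeff free_monoid K mone : {rmorphism {malg K[free_monoid]} -> K})).

Lemma const_coeff_gen x : const_coeff (free_gen x) = 0.
Proof. by rewrite /const_coeff mcoeffU1 fm1_eq1. Qed.

Lemma ideal_proper (S : free_alg -> Prop) :
  (forall x, S x -> const_coeff x = 0) -> ~ in_ideal S 1.
Proof.
move=> S0 S1; suff: const_coeff 1 = 0 by rewrite rmorph1; apply/eqP/oner_neq0.
elim: S1 => [x /S0||x y _ hx _ hy|a x _ hx|a x _ hx] //.
- by rewrite rmorph0.
- by rewrite rmorphD /= hx hy addr0.
- by rewrite rmorphM /= hx mulr0.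
- by rewrite rmorphM /= hx mul0r.
Qed.

End FreeAlg.

Section TensorAlgebra.
Variable V : lmodType K.

Inductive tensor_alg_rel : free_alg V -> Prop :=
| Tensor_alg_lin c u v :
    tensor_alg_rel (free_gen (c *: u + v) - (c *: free_gen u + free_gen v)).

Fact tensor_alg_proper : ~ in_ideal tensor_alg_rel 1.
Proof.
apply: ideal_proper => _ [c u v].
by rewrite (raddfB (@const_coeff _)) /= (linearP (@const_coeff _)) /= !const_coeff_gen mulr0 addr0 subr0.
Qed.

Definition tensor_alg : algType K := proper_alg_quot tensor_alg_proper.

Definition tensor_gen (v : V) : tensor_alg :=
  alg_proj tensor_alg_rel (free_gen v).

End TensorAlgebra.

Section Double.
Variables (A B : algType K) (sigma : tens A B -> tens B A).

Definition is_double : Prop :=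
  [/\ bijective sigma,
      forall t : tens (tens A A) B,
        sigma (tens_map tens_mul id t) =
        tens_map id tens_mul (tens_assoc (tens_map sigma id (tens_assoc_inv
          (tens_map id sigma (tens_assoc t))))),
      forall t : tens A (tens B B),
        sigma (tens_map id tens_mul t) =
        tens_map tens_mul id (tens_assoc_inv (tens_map id sigma (tens_assoc
          (tens_map sigma id (tens_assoc_inv t))))),
      forall b, sigma (pure_tens 1 b) = pure_tens b 1
    & forall a, sigma (pure_tens a 1) = pure_tens 1 a].

Definition sum_alg : algType K :=
  tensor_alg (GRing.Lmodule.clone K (A * B)%type _).
Definition sum_inl (a : A) : sum_alg := tensor_gen (a, 0).
Definition sum_inr (b : B) : sum_alg := tensor_gen (0, b).

(* [sum_alg] is the tensor algebra of the direct sum of A and B. Both units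
   are identified with its unit, and [b (x) a] is read as the product [b a]. *)
Inductive double_rel : sum_alg -> Prop :=
| Double_mulA a a' : double_rel (sum_inl a * sum_inl a' - sum_inl (a * a'))
| Double_oneA : double_rel (sum_inl 1 - 1)
| Double_mulB b b' : double_rel (sum_inr b * sum_inr b' - sum_inr (b * b'))
| Double_oneB : double_rel (sum_inr 1 - 1)
| Double_perm a b : double_rel
    (sum_inl a * sum_inr b - tens_lift (fun b' a' => sum_inr b' * sum_inl a')
                     (sigma (pure_tens a b))).

Definition double_alg : Type := alg_quot double_rel.
HB.instance Definition _ := GRing.PzRing.on double_alg.
HB.instance Definition _ := GRing.Lmodule.on double_alg.

Definition double_inl (a : A) : double_alg := alg_proj double_rel (sum_inl a).
Definition double_inr (b : B) : double_alg := alg_proj double_rel (sum_inr b).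

Definition double_act (eps : A -> K) (a : A) (b : B) : B :=
  tens_lift (fun b' a' => eps a' *: b') (sigma (pure_tens a b)).

End Double.

End Free.

Arguments free_alg K X : clear implicits.

Section Hecke.
Context {K : fieldType} {N : nat}.
Implicit Types (R Psi : 'M[K]_(N * N)) (X : 'M[K]_N).

(* The leftmost tensor factor is the major index of a Kronecker product. *)
Definition leg12 R : 'M[K]_(N * N * N) := R *t (1%:M : 'M_N).
Definition leg23 R : 'M[K]_(N * N * N) :=
  castmx (mulnA N N N, mulnA N N N) ((1%:M : 'M_N) *t R).

Definition braiding R : Prop :=
  leg12 R *m leg23 R *m leg12 R = leg23 R *m leg12 R *m leg23 R.

Definition hecke_symmetry (q : K) R : Prop :=
  [/\ q != 0, q != 1, q != -1, braiding R
    & R *m R = 1%:M + (q - q^-1) *: R].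

Definition flip : 'M[K]_(N * N) :=
  \matrix_(i, j) (mxtens_unindex i == ((mxtens_unindex j).2,
                                       (mxtens_unindex j).1))%:R.

(* Partial traces over the second factor of the tensor square and cube; the
   latter leaves an operator on the product of factors 1 and 3. *)
Definition ptrace2 Psi : 'M[K]_N :=
  \matrix_(i, j) \sum_k Psi (mxtens_index (i, k)) (mxtens_index (j, k)).

Definition ptrace2_cube (Y : 'M[K]_(N * N * N)) : 'M[K]_(N * N) :=
  \matrix_(s, t) \sum_k
    Y (mxtens_index (mxtens_index ((mxtens_unindex s).1, k),
                     (mxtens_unindex s).2))
      (mxtens_index (mxtens_index ((mxtens_unindex t).1, k),
                     (mxtens_unindex t).2)).

Definition skew_inverse R Psi : Prop :=
  ptrace2_cube (leg12 R *m leg23 Psi) = flip /\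
  ptrace2_cube (leg12 Psi *m leg23 R) = flip.

Section Relations.
Variable A : algType K.

Definition scalar_entries {m n} (Y : 'M[K]_(m, n)) : 'M[A]_(m, n) :=
  map_mx (in_alg A) Y.

Definition leg1 (X : 'M[A]_N) : 'M[A]_(N * N) := X *t (1%:M : 'M_N).

Definition RXR R (X : 'M[A]_N) : 'M[A]_(N * N) :=
  scalar_entries R *m leg1 X *m scalar_entries R.

Definition comm_R R (X : 'M[A]_N) : 'M[A]_(N * N) :=
  scalar_entries R *m leg1 X - leg1 X *m scalar_entries R.

Definition reflection R (X : 'M[A]_N) : 'M[A]_(N * N) :=
  RXR R X *m leg1 X - leg1 X *m RXR R X.

(* For [Psi] a skew-inverse of [R], [ptrace2 Psi] is the matrix usually written C,
   and Tr_R X = Tr (C X). *)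
Definition Rtrace Psi (X : 'M[A]_N) : A :=
  \tr (scalar_entries (ptrace2 Psi) *m X).

End Relations.

Section ReflectionAlgebras.
Variable R : 'M[K]_(N * N).

Local Notation Free := (free_alg K ('I_N * 'I_N)%type).

Definition free_mx : 'M[Free]_N := \matrix_(i, j) free_gen (i, j).

Inductive RE_rel : Free -> Prop :=
| RE_entry i j : RE_rel (reflection R free_mx i j).

Inductive mRE_rel : Free -> Prop :=
| mRE_entry i j : mRE_rel ((reflection R free_mx - comm_R R free_mx) i j).

Lemma const_coeff_mull (Y : 'M_(N * N)) i j :
  const_coeff ((Y *m leg1 free_mx) i j) = 0.
Proof.
rewrite mxE rmorph_sum big1 // => k _; rewrite rmorphM /=.
by rewrite /leg1 !mxE rmorphM /= const_coeff_gen mul0r mulr0.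
Qed.

Lemma const_coeff_mulr (Y : 'M_(N * N)) i j :
  const_coeff ((leg1 free_mx *m Y) i j) = 0.
Proof.
rewrite mxE rmorph_sum big1 // => k _; rewrite rmorphM /=.
by rewrite /leg1 !mxE rmorphM /= const_coeff_gen !mul0r.
Qed.

Lemma const_coeff_reflection i j : const_coeff (reflection R free_mx i j) = 0.
Proof.
rewrite /reflection mxE [X in _ + X]mxE (raddfB (@const_coeff _ _)) /=.
apply/eqP; rewrite subr_eq0; apply/eqP.
exact: etrans (const_coeff_mull (RXR R free_mx) i j)
              (esym (const_coeff_mulr (RXR R free_mx) i j)).
Qed.

Lemma const_coeff_comm_R i j : const_coeff (comm_R R free_mx i j) = 0.
Proof.
rewrite /comm_R mxE [X in _ + X]mxE (raddfB (@const_coeff _ _)) /=.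
apply/eqP; rewrite subr_eq0; apply/eqP.
exact: etrans (const_coeff_mull (scalar_entries _ R) i j)
              (esym (const_coeff_mulr (scalar_entries _ R) i j)).
Qed.

Fact RE_proper : ~ in_ideal RE_rel 1.
Proof. by apply: ideal_proper => _ [i j]; apply: const_coeff_reflection. Qed.

Fact mRE_proper : ~ in_ideal mRE_rel 1.
Proof.
apply: ideal_proper => _ [i j]; rewrite mxE [X in _ + X]mxE.
rewrite (raddfB (@const_coeff _ _)) /=.
apply/eqP; rewrite subr_eq0; apply/eqP.
exact: etrans (const_coeff_reflection i j) (esym (const_coeff_comm_R i j)).
Qed.

Definition REA : algType K := proper_alg_quot RE_proper.
Definition mREA : algType K := proper_alg_quot mRE_proper.

Definition REA_mx : 'M[REA]_N := map_mx (alg_proj RE_rel) free_mx.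
Definition mREA_mx : 'M[mREA]_N := map_mx (alg_proj mRE_rel) free_mx.

(* R_12 L_1 R_12 (x) M_1 |-> M_1 (x) R_12 L_1 R_12 + (R_12 M_1 - M_1 R_12) (x) 1,
   the matrices being multiplied with tensor products of their entries. *)
Definition RE_permutation (sigma : tens mREA REA -> tens REA mREA) : Prop :=
  map_mx sigma (tens_mulmx (RXR R mREA_mx) (leg1 REA_mx)) =
  tens_mulmx (leg1 REA_mx) (RXR R mREA_mx)
  + map_mx (fun b => pure_tens b 1) (comm_R R REA_mx).

End ReflectionAlgebras.
End Hecke.

(* Main.v *)
From HB Require Import structures.
Require Import Defs.
From mathcomp Require Import all_boot all_algebra.
From mathcomp Require Import reals complex.
From mathcomp Require Import mxtens monalg.

(** Write X1 = X (x) 1, and C for the partial trace of the skew-inverse, so that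
    Tr_R X = Tr (C X).

    Everything follows from one exchange rule inside the tensor product:
    sigma (l (x) Tr_R (M^k)) = Tr_R (M^k) (x) l for every entry l of L
    ([sigma_Rtrace]).  Reading it in the double gives the commutation, and
    applying the character, which kills l, gives the vanishing of the action.

    The permutation relation says that R L1 R - R commutes with M1.  Hence it
    commutes with every power of M1, that is,
    R L1 R M1^k - M1^k R L1 R = R M1^k - M1^k R.
    In the tensor product this is an induction on k, in which the compatibility of
    sigma with the product of the second algebra replaces associativity
    ([sigma_mulr], [permutesM]).

    Multiply by R^-1 on both sides and take the R-trace over the second tensor
    factor.  The left-hand side becomes L Tr_R (M^k) - Tr_R (M^k) L, because
    Tr_(2) C_2 R X_1 R^-1 = Tr_(2) C_2 R^-1 X_1 R = Tr_R X ([hecke_conj],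
    [hecke_conjV]).  The right-hand side becomes the partial R-trace of
    X_1 R^-1 - R^-1 X_1 with X = M^k.  By the Hecke relation R^-1 differs from R by
    a scalar, and Tr_(2) C_2 R = 1 ([mxtrace_tens_C]), so it is X - X = 0.

    The two trace identities are consequences of the braid relation
    ([mxtrace_conj]).  Skew-invertibility lets one write X_1 = Tr_(0) Y_0 R_01 with
    Tr Y = Tr_R X ([skew_representation]).  The braid relation turns
    R_12 R_01 R_12^-1 into R_01^-1 R_12 R_01, and Tr_(2) C_2 R_12 = 1 then leaves
    only Tr Y.

    Since the matrix entries live in noncommutative algebras and in tensor products
    without a multiplication, the whole contraction is encoded as a single linear
    functional T |-> Tr (Z T) with a scalar matrix Z ([contractor], [contract]).
    Expanding L and X over matrix units reduces it to identities between traces of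
    scalar matrices. *)

Set Implicit Arguments.
Unset Strict Implicit.
Unset Printing Implicit Defensive.

Import GRing.Theory.
Local Open Scope ring_scope.

Local Notation idx2 i j := (mxtens_index (i, j)).

(** * Linear maps and tensor products *)

Section LinearMaps.
Context {K : comNzRingType}.
Implicit Types U V W : lmodType K.

Lemma linear_map0 U W (f : U -> W) : linear f -> f 0 = 0.
Proof.
by move=> lf; have := lf (-1) 0 0; rewrite scaler0 addr0 scaleN1r addNr.
Qed.

Lemma linear_map_sum U W (f : U -> W) (I : finType) (u : I -> U) :
  linear f -> f (\sum_p u p) = \sum_p f (u p).
Proof.
move=> lf; apply: (big_morph f _ (linear_map0 lf)) => x y.
by rewrite -[x]scale1r lf !scale1r.
Qed.

Lemma linear_map_lincomb U W (f : U -> W) (I : finType) (c : I -> K)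
    (u : I -> U) :
  linear f -> f (\sum_p c p *: u p) = \sum_p c p *: f (u p).
Proof.
move=> lf; rewrite linear_map_sum //; apply: eq_bigr => p _.
by rewrite -[c p *: u p]addr0 lf linear_map0 // addr0.
Qed.

Lemma tens_ind U V (P : tens U V -> Prop) :
  P 0 -> (forall c s t, P s -> P t -> P (c *: s + t)) ->
  (forall u v, P (pure_tens u v)) -> forall t, P t.
Proof.
move=> P0 PD Pp t; rewrite -[t]span_reprK [repr t]monalgE.
rewrite (raddf_sum (span_proj _)) /=.
apply: big_ind => // [x y Px Py|p _].
  by rewrite -[x]scale1r; apply: PD.
have -> : << (repr t)@_p *g p >> = (repr t)@_p *: << p >> :> free_tens U V.
  by apply/malgP=> k; rewrite mcoeffZ !mcoeffU mulr_natr.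
rewrite -span_scaleE -[span_scale _ _]addr0; apply: PD => //.
by case: p => u v; apply: Pp.
Qed.

Lemma eq_on_tens U V W (f g : tens U V -> W) :
  linear f -> linear g ->
  (forall u v, f (pure_tens u v) = g (pure_tens u v)) -> f =1 g.
Proof.
move=> lf lg eq_fg; apply: tens_ind => // [|c s t hs ht].
  by rewrite !linear_map0.
by rewrite lf lg hs ht.
Qed.

Lemma pure_tensDl U V (u u' : U) (v : V) :
  pure_tens (u + u') v = pure_tens u v + pure_tens u' v.
Proof. by rewrite -[u]scale1r (pure_tens_bilin U V).1 !scale1r. Qed.

Lemma pure_tens_suml U V (I : finType) (u : I -> U) (v : V) :
  pure_tens (\sum_p u p) v = \sum_p pure_tens (u p) v.
Proof. exact: linear_map_sum ((pure_tens_bilin U V).1 v). Qed.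

Lemma pure_tens_sumr U V (I : finType) (u : U) (v : I -> V) :
  pure_tens u (\sum_p v p) = \sum_p pure_tens u (v p).
Proof. exact: linear_map_sum ((pure_tens_bilin U V).2 u). Qed.

Lemma pure_tens_lincomb U V (I J : finType) (c : I -> K) (d : J -> K)
    (u : I -> U) (v : J -> V) :
  pure_tens (\sum_p c p *: u p) (\sum_r d r *: v r) =
  \sum_p \sum_r (c p * d r) *: pure_tens (u p) (v r).
Proof.
have [linl linr] := pure_tens_bilin U V.
rewrite (linear_map_lincomb _ _ (linl _)); apply: eq_bigr => p _.
rewrite (linear_map_lincomb _ _ (linr _)) scaler_sumr.
by apply: eq_bigr => r _; rewrite scalerA.
Qed.

(** For a fixed representative of t, the value of [tens_lift] is a linear
    combination of values of the lifted map. *)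
Lemma tens_lift_param U V W (T : lmodType K) (f : T -> U -> V -> W) t :
  (forall u v, linear (fun x => f x u v)) ->
  linear (fun x => tens_lift (f x) t).
Proof.
move=> lf c x y; rewrite /tens_lift /malg_lift scaler_sumr -big_split /=.
by apply: eq_bigr => p _; rewrite lf scalerDr !scalerA mulrC.
Qed.

Section Maps.
Variables U U' V V' W : lmodType K.

Lemma tens_map_bilin (f : U -> U') (g : V -> V') :
  linear f -> linear g -> bilin (fun u v => pure_tens (f u) (g v)).
Proof.
move=> lf lg; split=> [v|u] c x y.
  by rewrite lf (pure_tens_bilin _ _).1.
by rewrite lg (pure_tens_bilin _ _).2.
Qed.

Lemma tens_map_linear (f : U -> U') (g : V -> V') :
  linear f -> linear g -> linear (tens_map f g).
Proof. by move=> lf lg; apply: tens_lift_linear (tens_map_bilin lf lg). Qed.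

Lemma tens_mapE (f : U -> U') (g : V -> V') u v :
  linear f -> linear g ->
  tens_map f g (pure_tens u v) = pure_tens (f u) (g v).
Proof. by move=> lf lg; apply: tens_liftE (tens_map_bilin lf lg) _ _. Qed.

Lemma assoc_inner_bilin (w : W) :
  bilin (fun (u : U) (v : V) => pure_tens u (pure_tens v w)).
Proof.
split=> [v|u] c x y; rewrite (pure_tens_bilin _ _).1 //.
by rewrite (pure_tens_bilin _ _).2.
Qed.

Lemma assoc_inv_inner_bilin (u : U) :
  bilin (fun (v : V) (w : W) => pure_tens (pure_tens u v) w).
Proof.
split=> [w|v] c x y; rewrite (pure_tens_bilin _ _).2 //.
by rewrite (pure_tens_bilin _ _).1.
Qed.

Lemma assoc_bilin : bilin (fun (t : tens U V) (w : W) =>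
  tens_lift (fun u v => pure_tens u (pure_tens v w)) t).
Proof.
split=> [w|t]; first exact: tens_lift_linear (assoc_inner_bilin w).
by apply: tens_lift_param => u v c x y; rewrite !(pure_tens_bilin _ _).2.
Qed.

Lemma assoc_inv_bilin : bilin (fun (u : U) (t : tens V W) =>
  tens_lift (fun v w => pure_tens (pure_tens u v) w) t).
Proof.
split=> [t|u]; last exact: tens_lift_linear (assoc_inv_inner_bilin u).
by apply: tens_lift_param => u v c x y; rewrite !(pure_tens_bilin _ _).1.
Qed.

Lemma tens_assocE (u : U) (v : V) (w : W) :
  tens_assoc (pure_tens (pure_tens u v) w) = pure_tens u (pure_tens v w).
Proof.
rewrite /tens_assoc (tens_liftE assoc_bilin).
by rewrite (tens_liftE (assoc_inner_bilin w)).
Qed.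

Lemma tens_assoc_invE (u : U) (v : V) (w : W) :
  tens_assoc_inv (pure_tens u (pure_tens v w)) = pure_tens (pure_tens u v) w.
Proof.
rewrite /tens_assoc_inv (tens_liftE assoc_inv_bilin).
by rewrite (tens_liftE (assoc_inv_inner_bilin u)).
Qed.

Lemma tens_assoc_linear : linear (@tens_assoc K U V W).
Proof. exact: tens_lift_linear assoc_bilin. Qed.

Lemma tens_assoc_inv_linear : linear (@tens_assoc_inv K U V W).
Proof. exact: tens_lift_linear assoc_inv_bilin. Qed.

End Maps.

Section Mul.
Variable A : algType K.

Lemma tens_mul_bilin : bilin (fun a a' : A => a * a').
Proof.
by split=> [b|a] c x y; rewrite ?mulrDl ?mulrDr -?scalerAl -?scalerAr.
Qed.

Lemma tens_mul_linear : linear (@tens_mul K A).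
Proof. exact: tens_lift_linear tens_mul_bilin. Qed.

Lemma tens_mulE (a a' : A) : tens_mul (pure_tens a a') = a * a'.
Proof. exact: tens_liftE tens_mul_bilin _ _. Qed.

End Mul.

End LinearMaps.

(** * The permutation map and products *)

Section ProductRule.
Context {K : comNzRingType}.
Variables (A B : algType K) (sigma : {linear tens A B -> tens B A}).
Hypothesis double_sigma : is_double sigma.

Definition tens_mull (b : B) : tens B A -> tens B A := tens_map ( *%R b) id.

Lemma tens_mull_bilin b :
  bilin (fun (b' : B) (a : A) => pure_tens (b * b') a).
Proof.
by apply: tens_map_bilin => // c x y; rewrite mulrDr -scalerAr.
Qed.

Lemma tens_mull_linear b : linear (tens_mull b).
Proof. exact: tens_lift_linear (tens_mull_bilin b). Qed.

HB.instance Definition _ b :=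
  GRing.isLinear.Build K (tens B A) (tens B A) *:%R (tens_mull b)
    (tens_mull_linear b).

Lemma tens_mullE b b' a :
  tens_mull b (pure_tens b' a) = pure_tens (b * b') a.
Proof. exact: tens_liftE (tens_mull_bilin b) _ _. Qed.

(** Right multiplication by b in the double, on normally ordered products:
    (b' a) b is brought back to normal order by exchanging a and b. *)
Definition sigma_past (b : B) : tens B A -> tens B A :=
  tens_lift (fun b' a => tens_mull b' (sigma (pure_tens a b))).

Lemma sigma_past_bilin b :
  bilin (fun b' a => tens_mull b' (sigma (pure_tens a b))).
Proof.
split=> [a|b'].
  apply: tens_lift_param => x y c b1 b2.
  by rewrite mulrDl -scalerAl (pure_tens_bilin _ _).1.
by move=> c a a'; rewrite (pure_tens_bilin _ _).1 !linearP.
Qed.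

Lemma sigma_past_linear b : linear (sigma_past b).
Proof. exact: tens_lift_linear (sigma_past_bilin b). Qed.

HB.instance Definition _ b :=
  GRing.isLinear.Build K (tens B A) (tens B A) *:%R (sigma_past b)
    (sigma_past_linear b).

Lemma sigma_pastE b b' a :
  sigma_past b (pure_tens b' a) = tens_mull b' (sigma (pure_tens a b)).
Proof. exact: tens_liftE (sigma_past_bilin b) _ _. Qed.

(** The axiom of a double for products in the second algebra, freed of
    associators: a is moved past b b' one factor at a time. *)
Lemma sigma_mulr a b b' :
  sigma (pure_tens a (b * b')) = sigma_past b' (sigma (pure_tens a b)).
Proof.
have lin_sigma : linear sigma by move=> c s t; rewrite linearP.
have lin_mul := @tens_mul_linear K B.
have [_ _ sigmaM _ _] := double_sigma.
have := sigmaM (pure_tens a (pure_tens b b')).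
rewrite tens_mapE ?tens_mulE => [->||] //.
rewrite tens_assoc_invE tens_mapE //.
(* Both sides are linear in each of the two successive values of sigma, so
   these may be taken to be pure tensors. *)
move: (sigma _) => t.
apply: (eq_on_tens (f := fun t => tens_map tens_mul id (tens_assoc_inv
  (tens_map id sigma (tens_assoc (pure_tens t b')))))).
- move=> c x y.
  rewrite (pure_tens_bilin _ _).1 tens_assoc_linear tens_map_linear //.
  by rewrite tens_assoc_inv_linear tens_map_linear.
- exact: sigma_past_linear.
move=> b1 a1; rewrite tens_assocE tens_mapE // sigma_pastE.
move: (sigma _); apply: eq_on_tens.
- move=> c x y.
  by rewrite (pure_tens_bilin _ _).2 tens_assoc_inv_linear tens_map_linear.
- exact: tens_mull_linear.
by move=> b2 a2; rewrite tens_assoc_invE tens_mapE ?tens_mulE ?tens_mullE.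
Qed.

End ProductRule.

(** * Reading an exchange rule in the double *)

Section DoubleAlgebra.
Context {K : comNzRingType}.
Variables (A B : algType K) (sigma : {linear tens A B -> tens B A}).

Lemma tensor_gen_linear (V : lmodType K) : linear (@tensor_gen K V).
Proof.
move=> c u v; apply/eqP; rewrite /tensor_gen.
rewrite -[X in _ == X](alg_proj_is_linear (@tensor_alg_rel K V)).
by apply/alg_proj_eqP/Ideal_gen/Tensor_alg_lin.
Qed.

Lemma sum_inl_linear : linear (@sum_inl K A B).
Proof.
move=> c a a'; rewrite /sum_inl -tensor_gen_linear; congr (tensor_gen _).
by apply: injective_projections; rewrite //= scaler0 addr0.
Qed.

Lemma sum_inr_linear : linear (@sum_inr K A B).
Proof.
move=> c b b'; rewrite /sum_inr -tensor_gen_linear; congr (tensor_gen _).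
by apply: injective_projections; rewrite //= scaler0 addr0.
Qed.

Lemma double_commute a b : sigma (pure_tens a b) = pure_tens b a ->
  double_inl sigma a * double_inr sigma b =
  double_inr sigma b * double_inl sigma a.
Proof.
move=> sab; rewrite /double_inl /double_inr.
rewrite -[LHS](alg_projM (double_rel sigma)).
rewrite -[RHS](alg_projM (double_rel sigma)).
apply/eqP/alg_proj_eqP.
have := Ideal_gen (Double_perm sigma a b); rewrite sab tens_liftE //.
split=> [a'|b'] c x y.
  by rewrite sum_inr_linear mulrDl scalerAl.
by rewrite sum_inl_linear mulrDr scalerAr.
Qed.

Lemma double_act0 (eps : A -> K) a b : scalar eps -> eps a = 0 ->
  sigma (pure_tens a b) = pure_tens b a -> double_act sigma eps a b = 0.
Proof.
move=> leps ea sab; rewrite /double_act sab tens_liftE ?ea ?scale0r //.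
split=> [a'|b'] c x y; first by rewrite scalerDr !scalerA mulrC.
by rewrite leps scalerDl scalerA.
Qed.

End DoubleAlgebra.

(** * Scalar matrices on the tensor square *)

Section TensorSquare.
Context {K : fieldType}.

Lemma sum_mxtens (V : nmodType) m n (F : 'I_(m * n) -> V) :
  \sum_s F s = \sum_i \sum_j F (idx2 i j).
Proof.
rewrite pair_big /= (reindex (@mxtens_index m n)) /=.
  by apply: eq_bigr => -[].
by exists (@mxtens_unindex m n) => s _;
  rewrite (mxtens_indexK, mxtens_unindexK).
Qed.

Lemma tensmx11 (S : pzRingType) m n :
  (1%:M : 'M[S]_m) *t (1%:M : 'M[S]_n) = 1%:M.
Proof.
apply/matrixP=> i j.
case: (mxtens_indexP i) => a b; case: (mxtens_indexP j) => c d.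
by rewrite tensmxE !mxE -natrM mulnb (can_eq (@mxtens_indexK _ _)).
Qed.

Lemma tensmx_linearl m n (F : 'M[K]_n) :
  linear (fun E : 'M[K]_m => E *t F).
Proof. by move=> c A B; apply/matrixP=> i j; rewrite !mxE mulrDl mulrA. Qed.

Lemma mxtrace_tens m n (E : 'M[K]_m) (F : 'M[K]_n) :
  \tr (E *t F) = \tr E * \tr F.
Proof. by rewrite /mxtrace mulr_sum; apply: eq_bigr => s _; rewrite mxE. Qed.

Lemma mxtraceB n (A B : 'M[K]_n) : \tr (A - B) = \tr A - \tr B.
Proof. exact: raddfB. Qed.

Lemma tens_mx_ind m n (P : 'M[K]_(m * n) -> Prop) :
  P 0 -> (forall c A B, P A -> P B -> P (c *: A + B)) ->
  (forall E F, P (E *t F)) -> forall W, P W.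
Proof.
move=> P0 PD Pt W; rewrite [W]matrix_sum_delta.
have PA A B : P A -> P B -> P (A + B) by rewrite -{2}[A]scale1r; apply: PD.
apply: big_ind => // s _; apply: big_ind => // t _.
rewrite -[_ *: _]addr0; apply: PD => //.
suff -> : delta_mx s t =
    delta_mx (mxtens_unindex s).1 (mxtens_unindex t).1
    *t delta_mx (mxtens_unindex s).2 (mxtens_unindex t).2 :> 'M[K]_(m * n).
  exact: Pt.
apply/matrixP=> i j.
case: (mxtens_indexP s) => s1 s2; case: (mxtens_indexP t) => t1 t2.
case: (mxtens_indexP i) => i1 i2; case: (mxtens_indexP j) => j1 j2.
rewrite tensmxE !mxE !mxtens_indexK -natrM mulnb /=.
rewrite !(can_eq (@mxtens_indexK _ _)) !xpair_eqE.
by congr (nat_of_bool _)%:R; rewrite andbACA.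
Qed.

End TensorSquare.

(** * Operators on the tensor cube *)

Section Legs.
Context {K : fieldType} {N : nat}.
Implicit Types (R W : 'M[K]_(N * N)) (X E : 'M[K]_N).

Lemma leg23E W a b c a' b' c' :
  leg23 W (idx2 (idx2 a b) c) (idx2 (idx2 a' b') c') =
  (a == a')%:R * W (idx2 b c) (idx2 b' c').
Proof.
have assoc x y z :
    cast_ord (esym (mulnA N N N)) (idx2 (idx2 x y) z) = idx2 x (idx2 y z).
  by apply: val_inj => /=; rewrite mulnDl mulnA addnA.
by rewrite /leg23 castmxE !assoc tensmxE mxE.
Qed.

Lemma leg12M W W' : leg12 (W *m W') = leg12 W *m leg12 W'.
Proof. by rewrite /leg12 tensmx_mul mul1mx. Qed.

Lemma leg23M W W' : leg23 (W *m W') = leg23 W *m leg23 W'.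
Proof.
have castM m n (e : m = n) (A B : 'M[K]_m) :
    castmx (e, e) (A *m B) = castmx (e, e) A *m castmx (e, e) B.
  by case: n / e.
by rewrite /leg23 -castM tensmx_mul mul1mx.
Qed.

Lemma mx3P (A B : 'M[K]_(N * N * N)) :
  (forall a b c a' b' c', A (idx2 (idx2 a b) c) (idx2 (idx2 a' b') c') =
     B (idx2 (idx2 a b) c) (idx2 (idx2 a' b') c')) -> A = B.
Proof.
move=> eqAB; apply/matrixP=> s t.
case: (mxtens_indexP s) => ab c; case: (mxtens_indexP ab) => a b.
by case: (mxtens_indexP t) => ab' c'; case: (mxtens_indexP ab') => a' b'.
Qed.

Lemma leg23_tens E X : leg23 (E *t X) = (1%:M *t E) *t X.
Proof. by apply: mx3P => *; rewrite leg23E !tensmxE mxE mulrA. Qed.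

Lemma leg12_1 : leg12 (1%:M : 'M[K]_(N * N)) = 1%:M.
Proof. exact: tensmx11. Qed.

Lemma leg23_1 : leg23 (1%:M : 'M[K]_(N * N)) = 1%:M.
Proof. by rewrite -tensmx11 leg23_tens !tensmx11. Qed.

Lemma leg23_linear : linear (@leg23 K N).
Proof.
move=> c W W'; apply: mx3P => *.
rewrite [RHS]mxE [X in _ = X + _]mxE !leg23E mxE mulrDr.
by rewrite [X in _ * X + _]mxE mulrCA.
Qed.

Lemma leg23_comm W X :
  leg23 W *m (X *t 1%:M *t 1%:M) = (X *t 1%:M *t 1%:M) *m leg23 W.
Proof.
move: W; apply: tens_mx_ind => [|c A B hA hB|E F].
- by rewrite (linear_map0 leg23_linear) mul0mx mulmx0.
- by rewrite leg23_linear mulmxDl mulmxDr -scalemxAl -scalemxAr hA hB.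
- by rewrite leg23_tens !tensmx_mul !(mul1mx, mulmx1).
Qed.

Lemma mxtrace_leg23 X W :
  \tr ((X *t 1%:M *t 1%:M) *m leg23 W) = \tr X * \tr W.
Proof.
move: W; apply: tens_mx_ind => [|c A B hA hB|E F].
- by rewrite (linear_map0 leg23_linear) mulmx0 !raddf0 mulr0.
- rewrite leg23_linear mulmxDr -scalemxAr !mxtraceD !mxtraceZ hA hB.
  by rewrite mulrDr mulrCA.
- by rewrite leg23_tens !tensmx_mul !(mul1mx, mulmx1) !mxtrace_tens mulrA.
Qed.

Lemma leg12_mul_leg23E R W a k c b l d :
  (leg12 R *m leg23 W) (idx2 (idx2 a k) c) (idx2 (idx2 b l) d) =
  \sum_m R (idx2 a k) (idx2 b m) * W (idx2 m c) (idx2 l d).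
Proof.
rewrite mxE sum_mxtens sum_mxtens (bigD1 b) //= [X in _ + X]big1 ?addr0.
  apply: eq_bigr => m _; rewrite (bigD1 c) //= big1 ?addr0.
    by rewrite leg23E tensmxE mxE !eqxx mulr1 mul1r.
  by move=> c' ne; rewrite tensmxE mxE eq_sym (negPf ne) mulr0 mul0r.
move=> b' ne; apply: big1 => m _; apply: big1 => c' _.
by rewrite leg23E (negPf ne) mul0r mulr0.
Qed.

Lemma flipE a b c d :
  (flip : 'M[K]_(N * N)) (idx2 a c) (idx2 b d) = ((a == d) && (c == b))%:R.
Proof. by rewrite mxE !mxtens_indexK. Qed.

Lemma ptrace2_cube_flip R W : ptrace2_cube (leg12 R *m leg23 W) = flip ->
  forall a b c d,
  \sum_k \sum_m R (idx2 a k) (idx2 b m) * W (idx2 m c) (idx2 k d) =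
  ((a == d) && (c == b))%:R :> K.
Proof.
move=> eqf a b c d; rewrite -flipE -eqf mxE !mxtens_indexK /=.
by apply: eq_bigr => k _; rewrite leg12_mul_leg23E.
Qed.

(** * Traces twisted by the skew-inverse *)

Section SkewInverse.
Variables R Psi : 'M[K]_(N * N).
Hypothesis skew : skew_inverse R Psi.
Local Notation C := (ptrace2 Psi).

(** The identity Tr_(2) C_2 R = 1, tested against E.  It is the trace over the
    third factor of Tr_(2) R_12 Psi_23 = P_13. *)
Lemma mxtrace_tens_C E : \tr ((E *t C) *m R) = \tr E.
Proof.
have RC a b : \sum_k \sum_m R (idx2 a k) (idx2 b m) * C m k = (a == b)%:R.
  transitivity (\sum_c \sum_k \sum_m
      R (idx2 a k) (idx2 b m) * Psi (idx2 m c) (idx2 k c)).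
    rewrite [RHS]exchange_big; apply: eq_bigr => k _ /=.
    rewrite [RHS]exchange_big; apply: eq_bigr => m _ /=.
    by rewrite mxE mulr_sumr.
  rewrite (eq_bigr _ (fun c _ => ptrace2_cube_flip skew.1 a b c c)).
  rewrite (bigD1 a) //= big1 ?addr0 ?eqxx // => c ne.
  by rewrite eq_sym (negPf ne).
transitivity (\sum_b \sum_a
    E b a * \sum_k \sum_m R (idx2 a k) (idx2 b m) * C m k).
  rewrite /mxtrace sum_mxtens; apply: eq_bigr => b _.
  transitivity (\sum_m \sum_a \sum_k
      E b a * (R (idx2 a k) (idx2 b m) * C m k)).
    apply: eq_bigr => m _; rewrite mxE sum_mxtens; apply: eq_bigr => a _.
    by apply: eq_bigr => k _; rewrite tensmxE -mulrA [C m k * _]mulrC.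
  rewrite exchange_big; apply: eq_bigr => a _ /=.
  rewrite exchange_big mulr_sumr; apply: eq_bigr => k _ /=.
  by rewrite mulr_sumr.
apply: eq_bigr => b _.
rewrite (bigD1 b) //= RC eqxx mulr1 big1 ?addr0 // => a ne.
by rewrite RC (negPf ne) mulr0.
Qed.

(** Every X has the form Tr_(0) Y_0 R_01, here tested against Z.  Since
    Tr_(1) Psi_01 R_12 = P_02, one has X_2 = Tr_(0) X_0 P_02 = Tr_(1) Y_1 R_12
    with Y_1 = Tr_(0) X_0 Psi_01, and the trace of this Y is Tr (C X) by the
    definition of C. *)
Lemma skew_representation X : exists2 Y : 'M[K]_N,
  \tr Y = \tr (C *m X) & forall Z, \tr (Z *m X) = \tr ((Y *t Z) *m R).
Proof.
pose Y : 'M[K]_N :=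
  \matrix_(k, m) \sum_a \sum_b X b a * Psi (idx2 a k) (idx2 b m).
have YR c d : \sum_k \sum_m Y k m * R (idx2 m c) (idx2 k d) = X c d.
  transitivity (\sum_a \sum_b X b a * ((a == d) && (c == b))%:R).
    pose G a b k m :=
      X b a * (Psi (idx2 a k) (idx2 b m) * R (idx2 m c) (idx2 k d)).
    transitivity (\sum_(x : 'I_N * 'I_N) \sum_(y : 'I_N * 'I_N)
                    G y.1 y.2 x.1 x.2).
      rewrite [LHS]pair_bigA; apply: eq_bigr => -[k m] _ /=.
      rewrite -[RHS](pair_bigA _ (fun a b => G a b k m)) mxE mulr_suml.
      apply: eq_bigr => a _; rewrite mulr_suml.
      by apply: eq_bigr => b _; rewrite -mulrA.
    rewrite exchange_big [RHS]pair_bigA; apply: eq_bigr => -[a b] _ /=.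
    rewrite -(ptrace2_cube_flip skew.2) -[LHS](pair_bigA _ (G a b)) mulr_sumr.
    by apply: eq_bigr => k _; rewrite mulr_sumr.
  rewrite (bigD1 d) //= [X in _ + X]big1 ?addr0 => [|a ne]; last first.
    by apply: big1 => b _; rewrite (negPf ne) mulr0.
  rewrite (bigD1 c) //= big1 ?addr0 ?eqxx ?mulr1 // => b ne.
  by rewrite [c == b]eq_sym (negPf ne) andbF mulr0.
exists Y.
  rewrite /mxtrace; under eq_bigr do rewrite mxE.
  rewrite exchange_big; apply: eq_bigr => a _ /=; rewrite exchange_big mxE.
  apply: eq_bigr => b _; rewrite mxE mulr_suml.
  by apply: eq_bigr => k _; rewrite mulrC.
move=> Z; pose G k d m c := Y k m * R (idx2 m c) (idx2 k d) * Z d c.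
transitivity (\sum_k \sum_d \sum_m \sum_c G k d m c); last first.
  rewrite /mxtrace sum_mxtens; apply: eq_bigr => k _; apply: eq_bigr => d _.
  rewrite mxE sum_mxtens; apply: eq_bigr => m _; apply: eq_bigr => c _.
  by rewrite tensmxE mulrAC.
rewrite exchange_big; apply: eq_bigr => d _ /=.
rewrite mxE; under [RHS]eq_bigr do rewrite exchange_big.
rewrite exchange_big; apply: eq_bigr => c _ /=; rewrite -YR mulrC mulr_suml.
by apply: eq_bigr => k _; rewrite mulr_suml.
Qed.

Lemma mxtrace_leg23_tens_C (G : 'M[K]_(N * N)) :
  \tr ((G *t C) *m leg23 R) = \tr G.
Proof.
move: G; apply: tens_mx_ind => [|c A B hA hB|Y E].
- by rewrite tens0mx mul0mx !raddf0.
- by rewrite tensmx_linearl mulmxDl -scalemxAl !mxtraceD !mxtraceZ hA hB.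
have -> : Y *t E *t C = (Y *t 1%:M *t 1%:M) *m leg23 (E *t C).
  by rewrite leg23_tens !tensmx_mul !(mul1mx, mulmx1).
by rewrite -mulmxA -leg23M mxtrace_leg23 mxtrace_tens_C mxtrace_tens.
Qed.

(** Substituting X_1 = Tr_(0) Y_0 R_01 adds a tensor factor on the left, so that
    an operator W on the square becomes [leg23 W] and R acts on the first two
    factors of the cube. *)
Lemma mxtrace_leg1 X Y W :
  (forall Z, \tr (Z *m X) = \tr ((Y *t Z) *m R)) ->
  \tr (W *m (X *t 1%:M)) =
  \tr (leg23 W *m ((Y *t 1%:M *t 1%:M) *m leg12 R)).
Proof.
move=> hY; move: W; apply: tens_mx_ind => [|c A B hA hB|E F].
- by rewrite (linear_map0 leg23_linear) !mul0mx !raddf0.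
- by rewrite leg23_linear !mulmxDl -!scalemxAl !mxtraceD !mxtraceZ hA hB.
- rewrite leg23_tens mulmxA /leg12 !tensmx_mul !(mul1mx, mulmx1).
  by rewrite !mxtrace_tens hY.
Qed.

(** The identity Tr_(2) C_2 U X_1 U' = Tr_R X, tested against E; it is stated
    for both U = R and U = R^-1 at once.  After [mxtrace_leg1], the braid-type
    hypothesis moves the conjugation from the factors 2, 3, where it meets C, to
    the factors 1, 2, where it disappears once C and R are traced out. *)
Lemma mxtrace_conj U U' E X : U *m U' = 1%:M ->
  leg23 U *m leg12 R *m leg23 U' = leg12 U' *m leg23 R *m leg12 U ->
  \tr ((E *t C) *m (U *m (X *t 1%:M) *m U')) = \tr E * \tr (C *m X).
Proof.
move=> UU' braidU; have [Y trY hY] := skew_representation X.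
have -> : \tr ((E *t C) *m (U *m (X *t 1%:M) *m U')) =
          \tr ((U' *m (E *t C) *m U) *m (X *t 1%:M)).
  by rewrite !mulmxA mxtrace_mulC !mulmxA.
rewrite (mxtrace_leg1 _ hY) !leg23M -!mulmxA (mulmxA (leg23 U)) leg23_comm.
rewrite mxtrace_mulC -!mulmxA (mulmxA (leg23 U)) braidU.
rewrite leg23_tens -!mulmxA !mulmxA mxtrace_mulC !mulmxA.
have -> : leg12 U *m (1%:M *t E *t C) *m (Y *t 1%:M *t 1%:M) *m leg12 U' =
          (U *m (Y *t E) *m U') *t C.
  rewrite /leg12 !tensmx_mul !(mul1mx, mulmx1) -[U *m _ *m (Y *t _)]mulmxA.
  by rewrite tensmx_mul mul1mx mulmx1.
rewrite mxtrace_leg23_tens_C -mulmxA mxtrace_mulC -mulmxA (mulmx1C UU') mulmx1.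
by rewrite mxtrace_tens trY mulrC.
Qed.

(** * Contracting the permutation relation of a Hecke symmetry *)

Section Hecke.
Variable q : K.
Hypothesis hecke_R : hecke_symmetry q R.

Definition hecke_inv : 'M[K]_(N * N) := R - (q - q^-1)%:M.
Local Notation R' := hecke_inv.

Lemma hecke_mulmxV : R *m R' = 1%:M.
Proof.
case: hecke_R => _ _ _ _ R2.
by rewrite /R' mulmxBr R2 mul_mx_scalar addrK.
Qed.

Lemma hecke_mulVmx : R' *m R = 1%:M.
Proof. exact: mulmx1C hecke_mulmxV. Qed.

Lemma hecke_conj E X :
  \tr ((E *t C) *m (R *m (X *t 1%:M) *m R')) = \tr E * \tr (C *m X).
Proof.
case: hecke_R => _ _ _ braid _; apply: mxtrace_conj hecke_mulmxV _.
have -> : leg23 R *m leg12 R = leg12 R' *m (leg12 R *m leg23 R *m leg12 R).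
  by rewrite -!mulmxA mulmxA -leg12M hecke_mulVmx leg12_1 mul1mx.
by rewrite braid -!mulmxA -leg23M hecke_mulmxV leg23_1 mulmx1.
Qed.

Lemma hecke_conjV E X :
  \tr ((E *t C) *m (R' *m (X *t 1%:M) *m R)) = \tr E * \tr (C *m X).
Proof.
case: hecke_R => _ _ _ braid _; apply: mxtrace_conj hecke_mulVmx _.
have -> : leg12 R *m leg23 R = leg23 R' *m (leg23 R *m leg12 R *m leg23 R).
  by rewrite -!mulmxA mulmxA -leg23M hecke_mulVmx leg23_1 mul1mx.
by rewrite -braid -!mulmxA -leg12M hecke_mulmxV leg12_1 mulmx1.
Qed.

(** The functional T |-> Tr ([contractor E] T) multiplies T by R^-1 on both
    sides, takes the R-trace over the second factor and pairs the result with
    E. *)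
Definition contractor E : 'M[K]_(N * N) := R' *m (E *t C) *m R'.

Lemma contractor_LX E A X :
  \tr (contractor E *m (R *m (A *t 1%:M) *m R *m (X *t 1%:M))) =
  \tr (E *m A) * \tr (C *m X).
Proof.
rewrite -hecke_conj -[in RHS](mulmx1 C) -tensmx_mul !mulmxA.
rewrite /contractor -[in LHS](mulmxA (R' *m _) R' R) hecke_mulVmx mulmx1.
by rewrite -!mulmxA mxtrace_mulC -!mulmxA.
Qed.

Lemma contractor_XL E A X :
  \tr (contractor E *m ((X *t 1%:M) *m (R *m (A *t 1%:M) *m R))) =
  \tr (C *m X) * \tr (E *m A).
Proof.
rewrite [\tr (E *m A)]mxtrace_mulC mulrC -hecke_conjV -[in RHS](mul1mx C).
rewrite -tensmx_mul /contractor -!mulmxA [LHS]mxtrace_mulC [RHS]mxtrace_mulC.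
by rewrite -!mulmxA hecke_mulmxV mulmx1.
Qed.

(** After cancellation this is the partial R-trace of X_1 R^-1 - R^-1 X_1, where
    R^-1 may be replaced by R because they differ by a scalar. *)
Lemma contractor_comm E X :
  \tr (contractor E *m (R *m (X *t 1%:M) - (X *t 1%:M) *m R)) = 0.
Proof.
have -> : \tr (contractor E *m (R *m (X *t 1%:M) - (X *t 1%:M) *m R)) =
          \tr ((E *t C) *m ((X *t 1%:M) *m R' - R' *m (X *t 1%:M))).
  rewrite /contractor !(mulmxBr _ (_ *m _)) !mxtraceB; congr (_ - _).
    by rewrite -!mulmxA mxtrace_mulC (mulmxA R') hecke_mulVmx mul1mx -!mulmxA.
  rewrite -!mulmxA mxtrace_mulC -!mulmxA.
  by rewrite hecke_mulmxV mulmx1.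
rewrite /R' (mulmxBr (X *t _)) mulmxBl mul_mx_scalar mul_scalar_mx opprB addrA.
rewrite subrK mulmxBr mxtraceB mulmxA tensmx_mul mulmx1 mxtrace_tens_C.
rewrite [X in _ - X]mxtrace_mulC -mulmxA [X in _ - X]mxtrace_mulC tensmx_mul.
by rewrite mul1mx mxtrace_tens_C mxtrace_mulC subrr.
Qed.

End Hecke.
End SkewInverse.
End Legs.

(** * Contractions of matrices over modules *)

Section Contraction.
Context {K : fieldType}.

Definition mx_lincomb (I : finType) (W : lmodType K) n (S : I -> 'M[K]_n)
    (w : I -> W) : 'M[W]_n :=
  \matrix_(s, t) \sum_p S p s t *: w p.

(** Tr (Z T), for T with entries in a module. *)
Definition contract (W : lmodType K) n (Z : 'M[K]_n) (T : 'M[W]_n) : W :=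
  \sum_s \sum_t Z t s *: T s t.

Lemma contractD (W : lmodType K) n (Z : 'M[K]_n) (T T' : 'M[W]_n) :
  contract Z (T + T') = contract Z T + contract Z T'.
Proof.
rewrite -big_split; apply: eq_bigr => s _; rewrite -big_split.
by apply: eq_bigr => t _; rewrite mxE scalerDr.
Qed.

Lemma contract_map (W W' : lmodType K) n (Z : 'M[K]_n) (f : W -> W')
    (T : 'M[W]_n) :
  linear f -> contract Z (map_mx f T) = f (contract Z T).
Proof.
move=> lf; rewrite /contract linear_map_sum //; apply: eq_bigr => s _.
by rewrite linear_map_lincomb //; apply: eq_bigr => t _; rewrite mxE.
Qed.

Lemma contract_delta (W : lmodType K) n (T : 'M[W]_n) i j :
  contract (delta_mx j i) T = T i j.
Proof.
rewrite /contract (bigD1 i) //= [X in _ + X]big1 ?addr0 => [|s ne]; last first.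
  by apply: big1 => t _; rewrite mxE (negPf ne) andbF scale0r.
rewrite (bigD1 j) //= mxE !eqxx scale1r big1 ?addr0 // => t ne.
by rewrite mxE (negPf ne) scale0r.
Qed.

Lemma contract_lincomb (I : finType) (W : lmodType K) n Z (S : I -> 'M[K]_n)
    (w : I -> W) :
  contract Z (mx_lincomb S w) = \sum_p \tr (Z *m S p) *: w p.
Proof.
transitivity (\sum_t \sum_s \sum_p (Z t s * S p s t) *: w p).
  rewrite exchange_big; apply: eq_bigr => s _; apply: eq_bigr => t _.
  by rewrite mxE scaler_sumr; apply: eq_bigr => p _; rewrite scalerA.
transitivity (\sum_t \sum_p (Z *m S p) t t *: w p).
  apply: eq_bigr => t _; rewrite exchange_big; apply: eq_bigr => p _ /=.
  by rewrite mxE scaler_suml.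
by rewrite exchange_big; apply: eq_bigr => p _; rewrite scaler_suml.
Qed.

Lemma tens_mulmx_lincomb (A B : lmodType K) (I J : finType) n
    (S : I -> 'M[K]_n) (T : J -> 'M[K]_n) (a : I -> A) (b : J -> B) :
  tens_mulmx (mx_lincomb S a) (mx_lincomb T b) =
  mx_lincomb (fun p : I * J => S p.1 *m T p.2)
             (fun p => pure_tens (a p.1) (b p.2)).
Proof.
apply/matrixP=> s t; rewrite !mxE.
under eq_bigr do rewrite !mxE pure_tens_lincomb pair_bigA /=.
by rewrite exchange_big; apply: eq_bigr => p _ /=; rewrite mxE scaler_suml.
Qed.

Section Algebra.
Variables (A : algType K) (n : nat).

Lemma scalar_mul_lincomb (I : finType) Y (S : I -> 'M[K]_n) (w : I -> A) :
  scalar_entries A Y *m mx_lincomb S w = mx_lincomb (fun p => Y *m S p) w.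
Proof.
apply/matrixP=> s t; rewrite !mxE.
under eq_bigr do rewrite !mxE mulr_algl scaler_sumr.
rewrite exchange_big; apply: eq_bigr => p _ /=; rewrite mxE scaler_suml.
by apply: eq_bigr => u _; rewrite scalerA.
Qed.

Lemma lincomb_mul_scalar (I : finType) Y (S : I -> 'M[K]_n) (w : I -> A) :
  mx_lincomb S w *m scalar_entries A Y = mx_lincomb (fun p => S p *m Y) w.
Proof.
apply/matrixP=> s t; rewrite !mxE.
under eq_bigr do rewrite !mxE mulr_algr scaler_sumr.
rewrite exchange_big; apply: eq_bigr => p _ /=; rewrite mxE scaler_suml.
by apply: eq_bigr => u _; rewrite scalerA mulrC.
Qed.

Lemma lincombB (I : finType) (S T : I -> 'M[K]_n) (w : I -> A) :
  mx_lincomb S w - mx_lincomb T w = mx_lincomb (fun p => S p - T p) w.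
Proof.
apply/matrixP=> s t; rewrite !mxE -sumrB.
by apply: eq_bigr => p _; rewrite !mxE scalerBl.
Qed.

Lemma lincomb_delta (X : 'M[A]_n) :
  X = mx_lincomb (fun p : 'I_n * 'I_n => delta_mx p.1 p.2)
                 (fun p => X p.1 p.2).
Proof.
apply/matrixP=> s t; rewrite mxE (bigD1 (s, t)) //= mxE !eqxx scale1r.
rewrite big1 ?addr0 // => -[s' t'] /=.
rewrite xpair_eqE mxE [s' == s]eq_sym [t' == t]eq_sym => /negPf ->.
by rewrite scale0r.
Qed.

Lemma leg1_lincomb (X : 'M[A]_n) :
  leg1 X = mx_lincomb (fun p : 'I_n * 'I_n => delta_mx p.1 p.2 *t 1%:M)
                      (fun p => X p.1 p.2).
Proof.
apply/matrixP=> s t; rewrite {1}[X]lincomb_delta !mxE mulr_suml.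
by apply: eq_bigr => p _; rewrite !mxE mulr_natr scalerMnl mulr_natr.
Qed.

Lemma contract_deltas (E : 'M[K]_n) (X : 'M[A]_n) :
  contract E X =
  \sum_(p : 'I_n * 'I_n) \tr (E *m delta_mx p.1 p.2) *: X p.1 p.2.
Proof. by rewrite {1}[X]lincomb_delta contract_lincomb. Qed.

Lemma Rtrace_contract Psi (X : 'M[A]_n) :
  Rtrace Psi X = contract (ptrace2 Psi) X.
Proof.
rewrite /Rtrace /mxtrace /contract exchange_big; apply: eq_bigr => t _ /=.
by rewrite mxE; apply: eq_bigr => s _; rewrite mxE mulr_algl.
Qed.

End Algebra.
End Contraction.

(** * The permutation relation and its powers *)

Section Permutation.
Context {K : fieldType}.
Variables (A B : algType K) (sigma : {linear tens A B -> tens B A}) (N : nat).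
Hypothesis double_sigma : is_double sigma.
Variables (R : 'M[K]_(N * N)) (L : 'M[A]_N).

(** The permutation relation of the double with the matrix of generators of
    the second algebra replaced by an arbitrary X. *)
Definition permutes (X : 'M[B]_N) : Prop :=
  map_mx sigma (tens_mulmx (RXR R L) (leg1 X)) =
  tens_mulmx (leg1 X) (RXR R L)
  + map_mx (fun b => pure_tens b 1) (comm_R R X).

Lemma leg1M (X Y : 'M[B]_N) : leg1 (X *m Y) = leg1 X *m leg1 Y.
Proof.
apply/matrixP=> i j.
case: (mxtens_indexP i) => a b; case: (mxtens_indexP j) => c d.
rewrite tensmxE !mxE mulr_suml sum_mxtens; apply: eq_bigr => k _.
rewrite (bigD1 b) //= big1 ?addr0 => [|e ne]; rewrite !tensmxE !mxE.
  by rewrite eqxx mulr1 mulrA.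
by rewrite eq_sym (negPf ne) mulr0 mul0r.
Qed.

Lemma comm_RM (X Y : 'M[B]_N) :
  comm_R R (X *m Y) = leg1 X *m comm_R R Y + comm_R R X *m leg1 Y.
Proof.
by rewrite /comm_R leg1M mulmxBr mulmxBl !mulmxA [RHS]addrC addrA subrK.
Qed.

(** R L1 R is moved past X1 and then past Y1; the two commutator terms left
    behind add up by the Leibniz rule [comm_RM]. *)
Lemma permutesM X Y : permutes X -> permutes Y -> permutes (X *m Y).
Proof.
have [_ _ _ sigma1 _] := double_sigma.
rewrite /permutes leg1M comm_RM.
set S := RXR R L; set X1 := leg1 X; set Y1 := leg1 Y.
set cX := comm_R R X; set cY := comm_R R Y => /matrixP pX /matrixP pY.
apply/matrixP=> s t.
have sX v : \sum_u sigma (pure_tens (S s u) (X1 u v)) =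
    \sum_u pure_tens (X1 s u) (S u v) + pure_tens (cX s v) 1.
  by have := pX s v; rewrite !mxE linear_sum.
have sY u : \sum_v sigma (pure_tens (S u v) (Y1 v t)) =
    \sum_v pure_tens (Y1 u v) (S v t) + pure_tens (cY u t) 1.
  by have := pY u t; rewrite !mxE linear_sum.
rewrite mxE [tens_mulmx _ _ _ _]mxE linear_sum [RHS]mxE.
rewrite [X in X + _]mxE [X in _ + X]mxE.
transitivity (\sum_v sigma_past sigma (Y1 v t)
                (\sum_u sigma (pure_tens (S s u) (X1 u v)))).
  under [RHS]eq_bigr do rewrite linear_sum.
  rewrite [RHS]exchange_big; apply: eq_bigr => u _ /=.
  rewrite [(X1 *m Y1) u t]mxE pure_tens_sumr linear_sum.
  by apply: eq_bigr => v _; apply: sigma_mulr.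
transitivity (\sum_u tens_mull (X1 s u)
                (\sum_v sigma (pure_tens (S u v) (Y1 v t)))
              + \sum_v pure_tens (cX s v * Y1 v t) 1).
  rewrite [in RHS](eq_bigr _ (fun u _ => linear_sum _ _ _ _)) /=.
  rewrite [X in _ = X + _]exchange_big -big_split; apply: eq_bigr => v _ /=.
  rewrite sX linearD /= [X in _ + X]sigma_pastE sigma1 tens_mullE.
  congr (_ + _); rewrite linear_sum; apply: eq_bigr => u _ /=.
  exact: sigma_pastE.
under eq_bigr => u _ do rewrite sY linearD linear_sum /= tens_mullE.
rewrite big_split /= -addrA; congr (_ + _).
  rewrite exchange_big; apply: eq_bigr => v _ /=.
  rewrite [(X1 *m Y1) s v]mxE pure_tens_suml.
  by apply: eq_bigr => u _; rewrite tens_mullE.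
rewrite -!pure_tens_suml [(X1 *m cY + cX *m Y1) s t]mxE.
by rewrite [(X1 *m cY) s t]mxE [(cX *m Y1) s t]mxE pure_tensDl.
Qed.

Lemma permutesX X k : (0 < k)%N -> permutes X -> permutes (X ^+ k).
Proof.
case: k => [//|k _ pX]; elim: k => [|k IHk]; first by rewrite expr1.
by rewrite exprS; apply: permutesM.
Qed.

Section Trace.
Variables (q : K) (Psi : 'M[K]_(N * N)).
Hypotheses (hecke_R : hecke_symmetry q R) (skew_R : skew_inverse R Psi).
Implicit Types (E : 'M[K]_N) (X : 'M[B]_N).
Local Notation Z := (contractor R Psi q).

Lemma RXR_lincomb : RXR R L =
  mx_lincomb (fun p : 'I_N * 'I_N => R *m (delta_mx p.1 p.2 *t 1%:M) *m R)
             (fun p => L p.1 p.2).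
Proof. by rewrite /RXR leg1_lincomb scalar_mul_lincomb lincomb_mul_scalar. Qed.

Lemma contract_LX E X :
  contract (Z E) (tens_mulmx (RXR R L) (leg1 X)) =
  pure_tens (contract E L) (Rtrace Psi X).
Proof.
rewrite Rtrace_contract RXR_lincomb leg1_lincomb tens_mulmx_lincomb.
rewrite contract_lincomb !contract_deltas pure_tens_lincomb pair_bigA.
by apply: eq_bigr => -[p r] _ /=; rewrite contractor_LX.
Qed.

Lemma contract_XL E X :
  contract (Z E) (tens_mulmx (leg1 X) (RXR R L)) =
  pure_tens (Rtrace Psi X) (contract E L).
Proof.
rewrite Rtrace_contract RXR_lincomb leg1_lincomb tens_mulmx_lincomb.
rewrite contract_lincomb !contract_deltas pure_tens_lincomb pair_bigA.
by apply: eq_bigr => -[p r] _ /=; rewrite contractor_XL.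
Qed.

Lemma contract_comm_R E X : contract (Z E) (comm_R R X) = 0.
Proof.
rewrite /comm_R leg1_lincomb scalar_mul_lincomb lincomb_mul_scalar lincombB.
by rewrite contract_lincomb big1 // => p _; rewrite contractor_comm ?scale0r.
Qed.

Lemma sigma_Rtrace X i j : permutes X ->
  sigma (pure_tens (L i j) (Rtrace Psi X)) = pure_tens (Rtrace Psi X) (L i j).
Proof.
have lin1 := (pure_tens_bilin B A).1 1.
(* Pairing with the matrix unit E_ji selects the entry (i, j) of L. *)
move=> /(congr1 (contract (Z (delta_mx j i)))).
rewrite contractD contract_map; last exact: linearP.
rewrite contract_LX contract_XL (contract_map _ _ lin1) contract_comm_R.
by rewrite contract_delta (linear_map0 lin1) addr0.
Qed.

End Trace.
End Permutation.

Local Open Scope complex_scope.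

Theorem proposition8 (Re : realType) (N : nat) (q : Re[i])
    (R Psi : 'M[Re[i]]_(N * N))
    (hecke_R : hecke_symmetry q R) (skew_R : skew_inverse R Psi)
    (sigma : {linear tens (mREA R) (REA R) -> tens (REA R) (mREA R)})
    (double_sigma : is_double sigma) (perm_sigma : RE_permutation sigma)
    (eps : {lrmorphism mREA R -> Re[i] | *%R})
    (eps_gen : forall i j : 'I_N, eps (mREA_mx R i j) = 0)
    (k : nat) (k_ge1 : (1 <= k)%N) :
  (forall i j : 'I_N,
     double_inl sigma (mREA_mx R i j)
       * double_inr sigma (Rtrace Psi (REA_mx R ^+ k)) =
     double_inr sigma (Rtrace Psi (REA_mx R ^+ k))
       * double_inl sigma (mREA_mx R i j)) /\
  (forall i j : 'I_N,
     double_act sigma eps (mREA_mx R i j) (Rtrace Psi (REA_mx R ^+ k)) = 0).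
Proof.
have swap i j :
    sigma (pure_tens (mREA_mx R i j) (Rtrace Psi (REA_mx R ^+ k))) =
    pure_tens (Rtrace Psi (REA_mx R ^+ k)) (mREA_mx R i j).
  have perm_Mk := permutesX double_sigma k_ge1 perm_sigma.
  exact: (sigma_Rtrace hecke_R skew_R _ _ perm_Mk).
split=> i j; first exact: double_commute.
by apply: double_act0 => // c u v; rewrite linearP.
Qed.
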